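(* Let $\alpha\in[0,1]$, let $G$ be a simple undirected graph on $n$ vertices, and let $x\in\mathbb{R}^n$ and $\lambda\in\mathbb{R}$ satisfy $B(G)x=\lambda x$. Let $G\cup\{u\}$ be the graph obtained from $G$ by adding a new vertex $u$ with no additional edges. Then $x$ can be extended to an eigenvector $y=[x,0]^T\in\mathbb{R}^{n+1}$ (with the entry $0$ at $u$) of $B(G\cup\{u\})$ corresponding to $\lambda$, that is, $B(G\cup\{u\})y=\lambda y$.
   Context: For a graph $G$, $A(G)$ is the adjacency matrix, $D(G)$ the diagonal degree matrix, $L(G)=D(G)-A(G)$ the Laplacian, and $B(G)=B_\alpha(G)=\alpha A(G)+(1-\alpha)L(G)$. *)

(* Defs.v *)
From HB Require Import structures.
From mathcomp Require Import all_boot all_order all_algebra.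
From mathcomp Require Import reals.

Set Implicit Arguments.
Unset Strict Implicit.
Unset Printing Implicit Defensive.

Import Order.TTheory GRing.Theory Num.Theory.
Local Open Scope ring_scope.

Record sgraph (n : nat) := SGraph {
  edge : rel 'I_n;
  edge_sym : symmetric edge;
  edge_irr : irreflexive edge }.

Definition degree n (G : sgraph n) (i : 'I_n) : nat := #|[set j | edge G i j]|.

Definition adj_mx (R : realType) n (G : sgraph n) : 'M[R]_n :=
  \matrix_(i, j) (edge G i j)%:R.

Definition deg_mx (R : realType) n (G : sgraph n) : 'M[R]_n :=
  diag_mx (\row_i (degree G i)%:R).

Definition lap_mx (R : realType) n (G : sgraph n) : 'M[R]_n :=
  deg_mx R G - adj_mx R G.

Definition B_mx (R : realType) (alpha : R) n (G : sgraph n) : 'M[R]_n :=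
  alpha *: adj_mx R G + (1 - alpha) *: lap_mx R G.

(* The old vertices are [lshift 1 i] for [i : 'I_n]; the new vertex u is the
   last one, [rshift n ord0], so that the vector [x, 0]^T is [col_mx x 0]. *)
Definition add_vertex_edge n (G : sgraph n) : rel 'I_(n + 1) :=
  fun i j => match split i, split j with
             | inl i', inl j' => edge G i' j'
             | _, _ => false
             end.

Lemma add_vertex_edge_sym n (G : sgraph n) : symmetric (add_vertex_edge G).
Proof.
move=> i j; rewrite /add_vertex_edge.
by case: (split i) => i'; case: (split j) => j' //; apply: edge_sym.
Qed.

Lemma add_vertex_edge_irr n (G : sgraph n) : irreflexive (add_vertex_edge G).
Proof.
by move=> i; rewrite /add_vertex_edge; case: (split i) => i' //; apply: edge_irr.
Qed.

Definition add_vertex n (G : sgraph n) : sgraph (n + 1) :=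
  SGraph (@add_vertex_edge_sym n G) (@add_vertex_edge_irr n G).

(* Main.v *)
(* In block form B(G ∪ {u}) = diag(B(G), 0): the vertex u is isolated and leaves
   the degrees of the old vertices unchanged. *)
Require Import Defs.
From HB Require Import structures.
From mathcomp Require Import all_boot all_order all_algebra.
From mathcomp Require Import reals.

Import Order.TTheory GRing.Theory Num.Theory.
Local Open Scope ring_scope.

(** Since [u] is isolated, its row and column in the adjacency matrix vanish, its degree is 0 and no
    old degree changes. So [adj_mx_add_vertex] and [deg_mx_add_vertex] border the old matrices with
    zeros, and [B_mx_add_vertex] follows because B is a linear combination of the two. Applied to
    [col_mx x 0], the bordered matrix gives B(G)x on top and 0 below. *)

Lemma split_lshift m n (i : 'I_m) : split (lshift n i) = inl i.
Proof. exact: (unsplitK (inl i)). Qed.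

Lemma split_rshift m n (i : 'I_n) : split (rshift m i) = inr i.
Proof. exact: (unsplitK (inr i)). Qed.

Lemma add_vertex_edge_lshift n (G : sgraph n) (i j : 'I_n) :
  edge (add_vertex G) (lshift 1 i) (lshift 1 j) = edge G i j.
Proof. by rewrite /= /add_vertex_edge !split_lshift. Qed.

Lemma add_vertex_edge_rshiftl n (G : sgraph n) (i : 'I_1) (j : 'I_(n + 1)) :
  edge (add_vertex G) (rshift n i) j = false.
Proof. by rewrite /= /add_vertex_edge split_rshift. Qed.

Lemma add_vertex_edge_rshiftr n (G : sgraph n) (i : 'I_(n + 1)) (j : 'I_1) :
  edge (add_vertex G) i (rshift n j) = false.
Proof. by rewrite edge_sym add_vertex_edge_rshiftl. Qed.

(** As a sum, the degree can be split into the contributions of the old vertices and of [u]. *)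
Lemma degreeE n (G : sgraph n) (i : 'I_n) :
  degree G i = (\sum_j edge G i j)%N.
Proof. by rewrite /degree cardsE -sum1_card big_mkcond. Qed.

Lemma degree_add_vertex_lshift n (G : sgraph n) (i : 'I_n) :
  degree (add_vertex G) (lshift 1 i) = degree G i.
Proof.
rewrite !degreeE big_split_ord -[RHS]addn0; congr (_ + _)%N.
  by apply: eq_bigr => j _; rewrite add_vertex_edge_lshift.
by rewrite big1 // => j _; rewrite add_vertex_edge_rshiftr.
Qed.

Lemma degree_add_vertex_rshift n (G : sgraph n) (i : 'I_1) :
  degree (add_vertex G) (rshift n i) = 0%N.
Proof. by rewrite degreeE big1 // => j _; rewrite add_vertex_edge_rshiftl. Qed.

Lemma adj_mx_add_vertex (R : realType) n (G : sgraph n) :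
  adj_mx R (add_vertex G) = block_mx (adj_mx R G) 0 0 0.
Proof.
rewrite -[LHS]submxK; congr block_mx; apply/matrixP => i j; rewrite !mxE.
- by rewrite add_vertex_edge_lshift.
- by rewrite add_vertex_edge_rshiftr.
- by rewrite add_vertex_edge_rshiftl.
- by rewrite add_vertex_edge_rshiftl.
Qed.

Lemma deg_mx_add_vertex (R : realType) n (G : sgraph n) :
  deg_mx R (add_vertex G) = block_mx (deg_mx R G) 0 0 0.
Proof.
rewrite -[LHS]submxK; congr block_mx; apply/matrixP => i j; rewrite !mxE.
(* Entry (i, j) of [diag_mx] is the degree of i times the indicator of i = j, and [lshift] is
   injective, so this indicator is that of the old indices. *)
- by rewrite degree_add_vertex_lshift eq_lshift.
- by rewrite eq_lrshift.
- by rewrite eq_rlshift.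
(* Here the indicator need not be evaluated: the degree of [u] is already 0. *)
- by rewrite degree_add_vertex_rshift mul0rn.
Qed.

Lemma B_mx_add_vertex (R : realType) (alpha : R) n (G : sgraph n) :
  B_mx alpha (add_vertex G) = block_mx (B_mx alpha G) 0 0 0.
Proof.
rewrite /B_mx /lap_mx adj_mx_add_vertex deg_mx_add_vertex.
by rewrite opp_block_mx add_block_mx !scale_block_mx add_block_mx
  !(oppr0, addr0, scaler0).
Qed.

Theorem theorem3p8 (R : realType) (alpha : R) (halpha : 0 <= alpha <= 1)
    (n : nat) (G : sgraph n) (x : 'cV[R]_n) (lambda : R)
    (hx : B_mx alpha G *m x = lambda *: x) :
  B_mx alpha (add_vertex G) *m col_mx x 0 = lambda *: col_mx x 0.
Proof.
by rewrite B_mx_add_vertex mul_block_col hx !mul0mx !addr0 scale_col_mx scaler0.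
Qed.
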